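(* Let $A$ be a ring. The following conditions on a Seifert $A$-module $(P,e)$ are equivalent: (i) $B(P,e)=0$. (ii) $(P,e)$ is a near-projection. (iii) There is a direct sum decomposition of Seifert $A$-modules $$(P,e)=(P^+,e^+)\oplus(P^-,e^-)$$ with $(P^+,e^+)$ unipotent and $(P^-,e^-)$ nilpotent.
   Context: $A$ is an associative ring with $1$. A Seifert $A$-module $(P,e)$ is a finitely generated projective $A$-module $P$ with an endomorphism $e:P\to P$. Its covering is the $A[z,z^{-1}]$-module $B(P,e)=\mathrm{coker}(1-e+ze:P[z,z^{-1}]\to P[z,z^{-1}])$, where $P[z,z^{-1}]=A[z,z^{-1}]\otimes_AP$. $(P,e)$ is nilpotent if $e^k=0$ for some $k\geq0$; unipotent if $(1-e)^k=0$ for some $k\geq 0$; a near-projection if $(e(1-e))^k=0$ for some $k\geq0$. *)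

(* Defs.v *)
From HB Require Import structures.
From mathcomp Require Import all_boot all_algebra.
From mathcomp Require Import generic_quotient ring_quotient.
From mathcomp Require Import finmap boolp.
From mathcomp.multinomials Require Import monalg.

Set Implicit Arguments.
Unset Strict Implicit.
Unset Printing Implicit Defensive.

Import GRing.Theory.
Local Open Scope ring_scope.
Local Open Scope quotient_scope.

(* "Ring" is [pzRingType]: associative and unital, not necessarily commutative,
   the zero ring allowed. "Module" is [lmodType]: left module.
   [{malg G[K]}] is the group of finitely supported functions K -> G. *)

Section FiniteSupport.
Variables (K : choiceType) (G U : zmodType).

Lemma malg_ind (Q : {malg G[K]} -> Prop) :
    Q 0 -> (forall f g, Q f -> Q g -> Q (f + g)) ->
    (forall k x, Q << x *g k >>) -> forall g, Q g.
Proof. by move=> Q0 QD QU g; rewrite (monalgE g); apply: big_ind. Qed.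

Variable F : K -> {additive G -> U}.

Definition malg_lift (g : {malg G[K]}) : U := \sum_(k <- msupp g) F k g@_k.

Lemma malg_liftEw (g : {malg G[K]}) (d : {fset K}) :
  (msupp g `<=` d)%fset -> malg_lift g = \sum_(k <- d) F k g@_k.
Proof.
move=> sd; apply: big_fset_incl => // k _ /mcoeff_outdom ->.
by rewrite raddf0.
Qed.

Fact malg_lift_is_zmod_morphism : zmod_morphism malg_lift.
Proof.
move=> f g.
rewrite (@malg_liftEw (f - g) (msupp f `|` msupp g)%fset) ?msuppB_le //.
rewrite (@malg_liftEw f (msupp f `|` msupp g)%fset) ?fsubsetUl //.
rewrite (@malg_liftEw g (msupp f `|` msupp g)%fset) ?fsubsetUr //.
by rewrite -sumrB; apply: eq_bigr => k _; rewrite !raddfB.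
Qed.

HB.instance Definition _ := GRing.isZmodMorphism.Build _ _ malg_lift
  malg_lift_is_zmod_morphism.

Lemma malg_liftU k x : malg_lift << x *g k >> = F k x.
Proof.
rewrite (@malg_liftEw _ [fset k]%fset) ?msuppU_le //.
by rewrite big_seq_fset1 mcoeffUU.
Qed.

End FiniteSupport.

(* The ring A[z,z^-1], in which z is central: [p@_i] is the coefficient of z^i
   in p, and [<< a *g i >>] is the monomial a z^i. *)

Definition laurent (A : pzRingType) : Type := {malg A[int]}.

Section Laurent.
Variable A : pzRingType.
Implicit Types (p q r : laurent A) (a b : A) (i j : int).

HB.instance Definition _ := GRing.Zmodule.on (laurent A).

Definition laurent_monom a i : laurent A := << a *g i >>.

Definition laurent_mul p q : laurent A :=
  \sum_(i <- msupp p) \sum_(j <- msupp q) laurent_monom (p@_i * q@_j) (i + j).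

Fact laurent_monom_is_zmod_morphism i : zmod_morphism (laurent_monom^~ i).
Proof. by move=> a b; rewrite /laurent_monom monalgUB. Qed.

Let mulM (a : A) i j b := laurent_monom (a * b) (i + j).
Fact mulM_is_zmod_morphism a i j : zmod_morphism (mulM a i j).
Proof. by move=> b c; rewrite /mulM mulrBr laurent_monom_is_zmod_morphism. Qed.
HB.instance Definition _ a i j := GRing.isZmodMorphism.Build _ _ (mulM a i j)
  (mulM_is_zmod_morphism a i j).

Let mulMp i q a := malg_lift (mulM a i) q.
Fact mulMp_is_zmod_morphism i q : zmod_morphism (mulMp i q).
Proof.
move=> a b; rewrite /mulMp /malg_lift -sumrB; apply: eq_bigr => j _.
by rewrite /= /mulM mulrBl laurent_monom_is_zmod_morphism.
Qed.
HB.instance Definition _ i q := GRing.isZmodMorphism.Build _ _ (mulMp i q)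
  (mulMp_is_zmod_morphism i q).

Let laurent_mulE p q : laurent_mul p q = malg_lift (mulMp^~ q) p.
Proof. by []. Qed.

Fact laurent_mulBl q : zmod_morphism (laurent_mul^~ q).
Proof. by move=> p p'; rewrite !laurent_mulE raddfB. Qed.

Fact laurent_mulBr p : zmod_morphism (laurent_mul p).
Proof.
move=> q q'; rewrite !laurent_mulE /malg_lift -sumrB; apply: eq_bigr => i _.
by rewrite /= /mulMp raddfB.
Qed.

Fact laurent_monomM a b i j :
  laurent_mul (laurent_monom a i) (laurent_monom b j)
    = laurent_monom (a * b) (i + j).
Proof. by rewrite laurent_mulE malg_liftU /= /mulMp malg_liftU. Qed.

Let mulr' q p := laurent_mul p q.
HB.instance Definition _ q := GRing.isZmodMorphism.Build _ _ (mulr' q)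
  (laurent_mulBl q).
HB.instance Definition _ p := GRing.isZmodMorphism.Build _ _ (laurent_mul p)
  (laurent_mulBr p).

Let mulDl : left_distributive laurent_mul +%R.
Proof. by move=> p p' q; apply: (raddfD (mulr' q)). Qed.

Let mulDr : right_distributive laurent_mul +%R.
Proof. by move=> p q q'; rewrite raddfD. Qed.

Let mul0 q : laurent_mul 0 q = 0. Proof. exact: (raddf0 (mulr' q)). Qed.
Let mulr0' q : laurent_mul q 0 = 0. Proof. exact: raddf0. Qed.

Fact laurent_mulA : associative laurent_mul.
Proof.
move=> p q r.
elim/malg_ind: p => [|p p' IH IH'|i a]; rewrite ?mul0 ?mulDl ?IH ?IH' //.
elim/malg_ind: q => [|q q' IH IH'|j b];
  rewrite ?mul0 ?mulr0' ?mul0 ?mulDl ?mulDr ?mulDl ?IH ?IH' //.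
elim/malg_ind: r => [|r r' IH IH'|k c]; rewrite ?mulr0' ?mulDr ?IH ?IH' //.
by rewrite !laurent_monomM mulrA addrA.
Qed.

Fact laurent_mul1 : left_id (laurent_monom 1 0) laurent_mul.
Proof.
move=> p; elim/malg_ind: p => [|p p' IH IH'|i a];
  rewrite ?mulr0' ?mulDr ?IH ?IH' //.
by rewrite laurent_monomM mul1r add0r.
Qed.

Fact laurent_mulr1 : right_id (laurent_monom 1 0) laurent_mul.
Proof.
move=> p; elim/malg_ind: p => [|p p' IH IH'|i a];
  rewrite ?mul0 ?mulDl ?IH ?IH' //.
by rewrite laurent_monomM mulr1 addr0.
Qed.

HB.instance Definition _ := GRing.Zmodule_isPzRing.Build (laurent A)
  laurent_mulA laurent_mul1 laurent_mulr1 mulDl mulDr.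

Definition laurentC a : laurent A := laurent_monom a 0.

Fact laurentC_is_zmod_morphism : zmod_morphism laurentC.
Proof. exact: laurent_monom_is_zmod_morphism. Qed.
HB.instance Definition _ := GRing.isZmodMorphism.Build _ _ laurentC
  laurentC_is_zmod_morphism.

Fact laurentC_is_monoid_morphism : monoid_morphism laurentC.
Proof. by split=> // a b; apply/esym; exact: (laurent_monomM a b 0 0). Qed.
HB.instance Definition _ := GRing.isMonoidMorphism.Build _ _ laurentC
  laurentC_is_monoid_morphism.

Definition laurentX : laurent A := laurent_monom 1 1.

Lemma laurentX_comm p : laurentX * p = p * laurentX.
Proof.
elim/malg_ind: p => [|p p' IH IH'|i a];
  rewrite ?mulr0 ?mul0r ?mulrDr ?mulrDl ?IH ?IH' //.
rewrite -[LHS]/(laurent_mul _ (laurent_monom a i)) -[RHS]/(laurent_mul _ _).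
by rewrite !laurent_monomM mulr1 mul1r addrC.
Qed.

End Laurent.

Section Coker.
Variables (R : pzRingType) (M N : lmodType R) (f : {linear M -> N}).

Definition im_pred : {pred N} := fun y => `[< exists x, f x = y >].

Fact im_zmod_closed : zmod_closed im_pred.
Proof.
split; first by apply/asboolP; exists 0; rewrite raddf0.
move=> _ _ /asboolP[x <-] /asboolP[y <-].
by apply/asboolP; exists (x - y); rewrite raddfB.
Qed.
HB.instance Definition _ := GRing.isZmodClosed.Build N im_pred im_zmod_closed.

Definition coker : Type := Quotient.quot im_pred.
HB.instance Definition _ := GRing.Zmodule.on coker.

Definition coker_pi (y : N) : coker := \pi_(Quotient.quot im_pred) y.

Fact coker_pi_is_zmod_morphism : zmod_morphism coker_pi.
Proof. by move=> x y; rewrite /coker_pi raddfB. Qed.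
HB.instance Definition _ := GRing.isZmodMorphism.Build _ _ coker_pi
  coker_pi_is_zmod_morphism.

Lemma coker_piP y y' : coker_pi y = coker_pi y' <-> exists x, f x = y - y'.
Proof.
have E := Quotient.idealrBE im_pred y y'.
split=> [yy'|im]; first by apply/asboolP; rewrite -[asbool _]/(y - y' \in im_pred) E; apply/eqP.
by apply/eqP; rewrite -[_ == _]E; apply/asboolP.
Qed.

Lemma coker_pi_surj (c : coker) : exists y, coker_pi y = c.
Proof. by exists (repr c); rewrite /coker_pi reprK. Qed.

Definition coker_scale (a : R) (c : coker) : coker := coker_pi (a *: repr c).

Lemma coker_scaleE a y : coker_scale a (coker_pi y) = coker_pi (a *: y).
Proof.
apply/coker_piP; have /coker_piP[x fx]: coker_pi (repr (coker_pi y)) = coker_pi y.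
  by rewrite /coker_pi reprK.
by exists (a *: x); rewrite linearZ /= fx scalerBr.
Qed.

Fact coker_scaleA a b c :
  coker_scale a (coker_scale b c) = coker_scale (a * b) c.
Proof. by have [y <-] := coker_pi_surj c; rewrite !coker_scaleE scalerA. Qed.

Fact coker_scale1 : left_id 1 coker_scale.
Proof. by move=> c; have [y <-] := coker_pi_surj c; rewrite coker_scaleE scale1r. Qed.

Fact coker_scaleDr : right_distributive coker_scale +%R.
Proof.
move=> a c c'; have [y <-] := coker_pi_surj c; have [y' <-] := coker_pi_surj c'.
by rewrite -raddfD !coker_scaleE scalerDr raddfD.
Qed.

Fact coker_scaleDl c : {morph coker_scale^~ c : a b / a + b}.
Proof.
by move=> a b; have [y <-] := coker_pi_surj c; rewrite !coker_scaleE scalerDl raddfD.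
Qed.

HB.instance Definition _ := GRing.Zmodule_isLmodule.Build R coker
  coker_scaleA coker_scale1 coker_scaleDr coker_scaleDl.

End Coker.

(* The left S-module S (x)_A P, for a ring morphism phi : A -> S and a left
   A-module P: the free abelian group on S x P modulo the usual relations. *)

Section Tensor.
Variables (A S : pzRingType) (phi : {rmorphism A -> S}) (P : lmodType A).

Let free := {malg int[(S * P)%type]}.

Definition pure (s : S) (x : P) : free := << 1 *g (s, x) >>.

Inductive tensor_rel : free -> Prop :=
| TensorDl s s' x : tensor_rel (pure (s + s') x - (pure s x + pure s' x))
| TensorDr s x x' : tensor_rel (pure s (x + x') - (pure s x + pure s x'))
| TensorM s a x : tensor_rel (pure (s * phi a) x - pure s (a *: x)).

(* the subgroup generated by [tensor_rel] *)
Definition tensor_pred : {pred free} := fun t =>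
  `[< forall H : zmodClosed free, (forall r, tensor_rel r -> r \in H) -> t \in H >].

Fact tensor_zmod_closed : zmod_closed tensor_pred.
Proof.
split; first by apply/asboolP => H _; exact: rpred0.
move=> t t' /asboolP Ht /asboolP Ht'; apply/asboolP => H HR.
by rewrite rpredB ?Ht ?Ht'.
Qed.
HB.instance Definition _ := GRing.isZmodClosed.Build free tensor_pred
  tensor_zmod_closed.

Definition tensor : Type := Quotient.quot tensor_pred.
HB.instance Definition _ := GRing.Zmodule.on tensor.

Definition tensor_pi (t : free) : tensor := \pi_(Quotient.quot tensor_pred) t.

Fact tensor_pi_is_zmod_morphism : zmod_morphism tensor_pi.
Proof. by move=> x y; rewrite /tensor_pi raddfB. Qed.
HB.instance Definition _ := GRing.isZmodMorphism.Build _ _ tensor_pi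
  tensor_pi_is_zmod_morphism.

Definition tens (s : S) (x : P) : tensor := tensor_pi (pure s x).

Let tensor_pi_rel r r' : tensor_rel (r - r') -> tensor_pi r = tensor_pi r'.
Proof.
move=> rel; apply/eqP; rewrite -[_ == _](Quotient.idealrBE tensor_pred).
by apply/asboolP => H; apply.
Qed.

Lemma tensDl s s' x : tens (s + s') x = tens s x + tens s' x.
Proof. by rewrite /tens -raddfD; apply: tensor_pi_rel; exact: TensorDl. Qed.

Lemma tensDr s x x' : tens s (x + x') = tens s x + tens s x'.
Proof. by rewrite /tens -raddfD; apply: tensor_pi_rel; exact: TensorDr. Qed.

Lemma tensM s a x : tens (s * phi a) x = tens s (a *: x).
Proof. by apply: tensor_pi_rel; exact: TensorM. Qed.

Lemma tensor_ind (Q : tensor -> Prop) :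
  Q 0 -> (forall t t', Q t -> Q t' -> Q (t + t')) -> (forall s x, Q (tens s x)) ->
  forall t, Q t.
Proof.
move=> Q0 QD QT t.
have tens0 x : tens 0 x = 0.
  by apply: (addrI (tens 0 x)); rewrite -tensDl !addr0.
have tensN s x : tens (- s) x = - tens s x.
  by apply/eqP; rewrite -addr_eq0 -tensDl addNr tens0.
have QMn s x n : Q (tens s x *+ n).
  by elim: n => [|n IH]; rewrite ?mulr0n ?mulrS //; apply: QD.
have -> : t = tensor_pi (repr t) by rewrite /tensor_pi reprK.
elim/malg_ind: (repr t) => [|f g Qf Qg|[s x] n]; rewrite ?raddf0 ?raddfD //.
  exact: QD.
have -> : << n *g (s, x) >> = pure s x *~ n by rewrite /pure -raddfMz /= intz.
rewrite raddfMz /= -/(tens s x).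
by case: n => n; rewrite ?NegzE -?pmulrn // -nmulrn -mulNrn -tensN; apply: QMn.
Qed.

(* the universal property, with values in an arbitrary abelian group *)
Section Lift.
Variables (U : zmodType) (b : S -> P -> U).

Definition balanced : Prop :=
  [/\ forall s s' x, b (s + s') x = b s x + b s' x,
      forall s x x', b s (x + x') = b s x + b s x' &
      forall s a x, b (s * phi a) x = b s (a *: x)].

Hypothesis b_bal : balanced.

Let mulz_b (k : S * P) (n : int) : U := b k.1 k.2 *~ n.
Let mulz_b_is_zmod_morphism k : zmod_morphism (mulz_b k).
Proof. by move=> m n; rewrite /mulz_b mulrzBr. Qed.
HB.instance Definition _ k := GRing.isZmodMorphism.Build _ _ (mulz_b k)
  (mulz_b_is_zmod_morphism k).

Let ker_pred : {pred free} := fun t => malg_lift mulz_b t == 0.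
Let ker_zmod_closed : zmod_closed ker_pred.
Proof.
split; first by rewrite unfold_in /ker_pred raddf0.
by move=> x y; rewrite !unfold_in /ker_pred => /eqP x0 /eqP y0; rewrite raddfB /= x0 y0 subr0.
Qed.
HB.instance Definition _ := GRing.isZmodClosed.Build free ker_pred ker_zmod_closed.

Definition tensor_lift (t : tensor) : U := malg_lift mulz_b (repr t).

Let tensor_lift_pi t : tensor_lift (tensor_pi t) = malg_lift mulz_b t.
Proof.
have /eqP : tensor_pi (repr (tensor_pi t)) = tensor_pi t by rewrite /tensor_pi reprK.
rewrite -[_ == _](Quotient.idealrBE tensor_pred) => /asboolP/(_ ker_pred) kerP.
apply/eqP; rewrite -subr_eq0 /tensor_lift -raddfB; apply: kerP => r.
have [bDl bDr bM] := b_bal.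
case=> [s s' x|s x x'|s a x]; rewrite unfold_in /ker_pred raddfB /= ?raddfD /=
  !malg_liftU /= /mulz_b /= !mulr1z ?bDl ?bDr ?bM; by rewrite -?opprD subrr.
Qed.

Lemma tensor_liftE s x : tensor_lift (tens s x) = b s x.
Proof. by rewrite tensor_lift_pi malg_liftU /= /mulz_b mulr1z. Qed.

Fact tensor_lift_is_zmod_morphism : zmod_morphism tensor_lift.
Proof.
move=> t t'; rewrite -[t]reprK -[t']reprK -[\pi _ - _]tensor_pi_is_zmod_morphism.
by rewrite !tensor_lift_pi raddfB.
Qed.

End Lift.

Definition tensor_scale (a : S) : tensor -> tensor :=
  tensor_lift (fun s x => tens (a * s) x).

Let tensor_scale_bal a : balanced (fun s x => tens (a * s) x).
Proof.
by split=> *; rewrite ?mulrDr ?tensDl ?tensDr ?mulrA ?tensM.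
Qed.

Lemma tensor_scaleE a s x : tensor_scale a (tens s x) = tens (a * s) x.
Proof. exact: (tensor_liftE (tensor_scale_bal a)). Qed.

HB.instance Definition _ a := GRing.isZmodMorphism.Build _ _ (tensor_scale a)
  (tensor_lift_is_zmod_morphism (tensor_scale_bal a)).

Fact tensor_scaleA a b t : tensor_scale a (tensor_scale b t) = tensor_scale (a * b) t.
Proof.
elim/tensor_ind: t => [|t t' IH IH'|s x]; rewrite ?raddf0 ?raddfD /= ?IH ?IH' //.
by rewrite !tensor_scaleE mulrA.
Qed.

Fact tensor_scale1 : left_id 1 tensor_scale.
Proof.
move=> t; elim/tensor_ind: t => [|t t' IH IH'|s x]; rewrite ?raddf0 ?raddfD /= ?IH ?IH' //.
by rewrite tensor_scaleE mul1r.
Qed.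

Fact tensor_scaleDr : right_distributive tensor_scale +%R.
Proof. by move=> a t t'; rewrite raddfD. Qed.

Fact tensor_scaleDl t : {morph tensor_scale^~ t : a b / a + b}.
Proof.
move=> a b; elim/tensor_ind: t => [|t t' IH IH'|s x].
- by rewrite !raddf0 addr0.
- by rewrite !raddfD /= IH IH' addrACA.
- by rewrite !tensor_scaleE mulrDl tensDl.
Qed.

HB.instance Definition _ := GRing.Zmodule_isLmodule.Build S tensor
  tensor_scaleA tensor_scale1 tensor_scaleDr tensor_scaleDl.

Lemma tensZ a s x : a *: tens s x = tens (a * s) x.
Proof. exact: tensor_scaleE. Qed.

End Tensor.

Section TensorMap.
Variables (A S : pzRingType) (phi : {rmorphism A -> S}) (P Q : lmodType A).
Variable f : {linear P -> Q}.

(* id_S (x) f *)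
Definition tensor_map : tensor phi P -> tensor phi Q :=
  tensor_lift (fun s x => tens phi s (f x)).

Let tensor_map_bal : balanced phi (fun s x => tens phi s (f x)).
Proof. by split=> *; rewrite ?linearZ ?raddfD /= ?tensDl ?tensDr ?tensM. Qed.

Lemma tensor_mapE s x : tensor_map (tens phi s x) = tens phi s (f x).
Proof. exact: (tensor_liftE tensor_map_bal). Qed.

HB.instance Definition _ := GRing.isZmodMorphism.Build _ _ tensor_map
  (tensor_lift_is_zmod_morphism tensor_map_bal).

Fact tensor_map_is_scalable : scalable tensor_map.
Proof.
move=> a t; elim/tensor_ind: t => [|t t' IH IH'|s x].
- by rewrite scaler0 raddf0 scaler0.
- by rewrite scalerDr !raddfD /= IH IH'.
- by rewrite tensZ !tensor_mapE tensZ.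
Qed.
HB.instance Definition _ := GRing.isScalable.Build S _ _ *:%R tensor_map
  tensor_map_is_scalable.

End TensorMap.

Definition finitely_generated (A : pzRingType) (P : lmodType A) : Prop :=
  exists (n : nat) (g : 'I_n -> P),
    forall x : P, exists c : 'I_n -> A, x = \sum_(i < n) c i *: g i.

Definition projective (A : pzRingType) (P : lmodType A) : Prop :=
  forall (M N : lmodType A) (p : {linear M -> N}) (g : {linear P -> N}),
    (forall y : N, exists x : M, p x = y) ->
    exists h : {linear P -> M}, forall x : P, p (h x) = g x.

Record seifert (A : pzRingType) := Seifert {
  seifert_mod :> lmodType A;
  seifert_end : {linear seifert_mod -> seifert_mod};
  seifert_fg : finitely_generated seifert_mod;
  seifert_proj : projective seifert_mod
}.

Lemma central_pencil_is_linear (R : pzRingType) (V : lmodType R)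
    (g : {linear V -> V}) (c : R) :
  (forall r, c * r = r * c) -> linear (fun t => t - g t + c *: g t).
Proof.
move=> cC a t t'; rewrite linearP !scalerDr !scalerN !scalerA cC opprD.
by rewrite (addrACA (a *: t)) (addrACA (a *: t - _)).
Qed.

Section Covering.
Variables (A : pzRingType) (M : seifert A).

(* P[z,z^-1] *)
Definition laurent_mod : lmodType (laurent A) := tensor (@laurentC A) M.

(* 1 - e + z e *)
Definition covering_map (t : laurent_mod) : laurent_mod :=
  t - tensor_map (seifert_end M) t
    + @laurentX A *: (tensor_map (seifert_end M) t : laurent_mod).

Fact covering_map_is_linear : linear covering_map.
Proof. exact: central_pencil_is_linear (@laurentX_comm A). Qed.
HB.instance Definition _ := GRing.isLinear.Build (laurent A) _ _ *:%R covering_map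
  covering_map_is_linear.

Definition covering : lmodType (laurent A) := coker covering_map.

Definition is_nilpotent : Prop :=
  exists k : nat, forall x : M, iter k (seifert_end M) x = 0.

Definition is_unipotent : Prop :=
  exists k : nat, forall x : M, iter k (fun y => y - seifert_end M y) x = 0.

Definition is_near_projection : Prop :=
  exists k : nat, forall x : M,
    iter k (fun y => seifert_end M (y - seifert_end M y)) x = 0.

End Covering.

Definition zero_module (R : pzRingType) (M : lmodType R) : Prop :=
  forall x : M, x = 0.

Section DirectSum.
Variables (A : pzRingType) (M N : seifert A).

Definition sum_end (x : M * N) : M * N := (seifert_end M x.1, seifert_end N x.2).

Fact sum_end_is_linear : linear sum_end.
Proof. by move=> a x y; rewrite /sum_end /= !linearP. Qed.
HB.instance Definition _ := GRing.isLinear.Build A _ _ *:%R sum_end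
  sum_end_is_linear.

Fact sum_fg : finitely_generated (M * N)%type.
Proof.
have [m [g gP]] := seifert_fg M; have [n [h hP]] := seifert_fg N.
exists (m + n)%N, (fun k => match split k with inl i => (g i, 0) | inr j => (0, h j) end).
move=> [x y]; have [c ->] := gP x; have [d ->] := hP y.
exists (fun k => match split k with inl i => c i | inr j => d j end).
have splitl i : split (lshift n i) = inl i := unsplitK (inl i : 'I_m + 'I_n).
have splitr j : split (rshift m j) = inr j := unsplitK (inr j : 'I_m + 'I_n).
rewrite big_split_ord /= [X in _ = X + _](eq_bigr (fun i => (c i *: g i, 0))).
  rewrite [X in _ = _ + X](eq_bigr (fun i => (0, d i *: h i))).
    have sumE I (r : seq I) (F : I -> M * N) :
        \sum_(i <- r) F i = (\sum_(i <- r) (F i).1, \sum_(i <- r) (F i).2).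
      elim: r => [|i r IH]; first by rewrite !big_nil.
      by rewrite !big_cons IH; case: (F i).
    rewrite !sumE /= !big1_eq -[RHS]/(_ + 0, 0 + _).
    by rewrite addr0 add0r.
  by move=> j _; rewrite splitr -[LHS]/(_ *: _, _ *: _) scaler0.
by move=> i _; rewrite splitl -[LHS]/(_ *: _, _ *: _) scaler0.
Qed.

Fact sum_proj : projective (M * N)%type.
Proof.
move=> X Y p g p_surj.
have lin1 : linear (fun x : M => g (x, 0)).
  by move=> a x y; rewrite -linearP; congr (g (_, _)); rewrite /= scaler0 addr0.
have lin2 : linear (fun y : N => g (0, y)).
  by move=> a x y; rewrite -linearP; congr (g (_, _)); rewrite /= scaler0 addr0.
pose g1 : {linear M -> Y} := HB.pack (fun x : M => g (x, 0)) (GRing.isLinear.Build A M Y _ _ lin1).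
pose g2 : {linear N -> Y} := HB.pack (fun x : N => g (0, x)) (GRing.isLinear.Build A N Y _ _ lin2).
have [h1 h1P] := seifert_proj g1 p_surj; have [h2 h2P] := seifert_proj g2 p_surj.
have linh : linear (fun x : M * N => h1 x.1 + h2 x.2).
  by move=> a x y; rewrite /= !linearP scalerDr addrACA.
pose h : {linear (M * N)%type -> X} := HB.pack (fun x : M * N => h1 x.1 + h2 x.2)
  (GRing.isLinear.Build A (M * N)%type X _ _ linh).
exists h => -[x y]; rewrite /h /= raddfD /= h1P h2P /= -raddfD.
by congr (g (_, _)); rewrite /= ?addr0 ?add0r.
Qed.

Definition seifert_sum : seifert A :=
  @Seifert A (M * N)%type sum_end sum_fg sum_proj.

End DirectSum.

Definition seifert_iso (A : pzRingType) (M N : seifert A) : Prop :=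
  exists f : {linear M -> N},
    bijective f /\ forall x : M, f (seifert_end M x) = seifert_end N (f x).

(* Main.v *)
Require Import Defs.
From mathcomp Require Import all_boot all_algebra.
From HB Require Import structures.
From mathcomp Require Import boolp.
From mathcomp.multinomials Require Import monalg.
From mathcomp Require Import zify.

(** Write f = 1 - e. Since e + f = 1, powers of e and f are comaximal: every x
    is e^m a + f^n b ([bezout]), and ker e^m meets ker f^n trivially
    ([ker_iter_disjoint]). The equivalences all come from this.

    If (e f)^k = 0, then M is the direct sum of ker f^k and ker e^k
    ([near_projection_split]). Both are stable under e; being direct summands
    they are finitely generated and projective, and they are the unipotent and
    the nilpotent part. Conversely (e f)^k = e^k f^k vanishes on a unipotent or
    a nilpotent module, hence on a sum of two such modules.

    The pencil 1 - e + z e equals 1 - (1 - z) e and also z (1 - (1 - z^-1) f).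
    On the kernel of a power of e, respectively f, a geometric series inverts
    it, so it is onto as soon as e f is nilpotent ([pencil_surj]), and the
    covering vanishes.

    If the covering vanishes, let 1 (x) y be the image of t, and let x_i be the
    coefficient of z^i in t. Then f x_i + e x_(i-1) is y for i = 0 and 0
    otherwise. As x_i = 0 for large |i|, descending from the right gives
    e^n x_0 = 0 and ascending from the left gives f^n x_(-1) = 0, so that
    e^n f^n y = 0 ([recurrence_near_proj]). Finite generation makes n
    independent of y ([fg_nilpotent]). *)

Set Implicit Arguments.
Unset Strict Implicit.
Unset Printing Implicit Defensive.

Import GRing.Theory.
Local Open Scope ring_scope.

(** * Iterates of additive and linear maps *)

Lemma iter_raddf0 (V : zmodType) (g : {additive V -> V}) k : iter k g 0 = 0.
Proof. by elim: k => //= k ->; rewrite raddf0. Qed.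

Lemma iter_raddfD (V : zmodType) (g : {additive V -> V}) k x y :
  iter k g (x + y) = iter k g x + iter k g y.
Proof. by elim: k => //= k ->; rewrite raddfD. Qed.

Lemma iter_is_linear (R : pzRingType) (V : lmodType R) (g : {linear V -> V}) k :
  linear (iter k g).
Proof. by move=> a x y; elim: k => //= k ->; rewrite linearP. Qed.

HB.instance Definition _ (R : pzRingType) (V : lmodType R)
    (g : {linear V -> V}) k :=
  GRing.isLinear.Build R V V *:%R (iter k g) (iter_is_linear g k).

Section Commute.
Variables (T : Type) (f g : T -> T).
Hypothesis fgC : forall x, f (g x) = g (f x).

Lemma iter_comm1 n x : iter n f (g x) = g (iter n f x).
Proof. by elim: n => //= n ->; rewrite fgC. Qed.

Lemma iter_comm m n x : iter m f (iter n g x) = iter n g (iter m f x).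
Proof. by elim: n => //= n <-; rewrite iter_comm1. Qed.

Lemma iter_comp_comm n x :
  iter n (fun y => f (g y)) x = iter n f (iter n g x).
Proof. by elim: n => //= n ->; rewrite -iter_comm1. Qed.

End Commute.

(** * Near-projections on an abelian group *)

Section NearProjection.
Variables (V : zmodType) (e : {additive V -> V}).

Local Notation f := (idfun \- e).

Lemma compl_comm x : e (f x) = f (e x).
Proof. by rewrite /= raddfB. Qed.

Lemma add_compl x : x = e x + f x.
Proof. by rewrite /= addrC subrK. Qed.

Lemma near_projE k x :
  iter k (fun y => e (y - e y)) x = iter k e (iter k f x).
Proof. exact: (iter_comp_comm compl_comm). Qed.

(** Replacing f^n b by e f^n b + f^(n+1) b raises the exponent of f. *)
Lemma bezout1 n x : exists a b, x = e a + iter n f b.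
Proof.
elim: n => [|n [a [b xE]]]; first by exists 0, x; rewrite raddf0 add0r.
exists (a + iter n f b), b.
by rewrite {1}xE {1}(add_compl (iter n f b)) addrA -raddfD.
Qed.

Lemma bezout m n x : exists a b, x = iter m e a + iter n f b.
Proof.
elim: m => [|m [a [b xE]]]; first by exists x, 0; rewrite iter_raddf0 addr0.
have [a' [b' aE]] := bezout1 n a.
exists a', (iter m e b' + b).
rewrite {1}xE {1}aE !iter_raddfD iterSr -addrA; congr (_ + (_ + _)).
exact: (iter_comm compl_comm).
Qed.

Lemma ker_iter_disjoint m n x : iter m e x = 0 -> iter n f x = 0 -> x = 0.
Proof.
elim: m x => [//|m IH] x; rewrite iterSr => ex0 fx0.
have ex : e x = 0.
  apply: IH => //; rewrite (iter_comm1 (g := e)) => [|y]; last first.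
    by rewrite compl_comm.
  by rewrite fx0 raddf0.
(* As e x = 0, the map f fixes x. *)
have fE j : iter j f x = x by elim: j => //= j ->; rewrite ex subr0.
by rewrite -(fE n).
Qed.

End NearProjection.

(** Geometric series: 1 - g is onto the elements killed by a power of g. *)
Lemma sub_nilpotent_surj (V : zmodType) (g : {additive V -> V}) n y :
  iter n g y = 0 -> exists x, x - g x = y.
Proof.
elim: n y => [|n IH] y; first by move=> /= ->; exists 0; rewrite raddf0 subrr.
rewrite iterSr => /IH[x gy].
by exists (y + x); rewrite raddfD opprD addrACA gy subrK.
Qed.

(** * Surjectivity of the pencil 1 - e + c e *)

Section Pencil.
Variables (R : pzRingType) (V : lmodType R) (e : {linear V -> V}).

Local Notation f := (idfun \- e).

Lemma sub_scale_nilpotent_surj (g : {linear V -> V}) (r : R) n y :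
  iter n g y = 0 -> exists x, x - r *: g x = y.
Proof.
move=> gy0.
pose h : {additive V -> V} := (GRing.scale r \o g).
apply: (@sub_nilpotent_surj _ h n).
have gC x : g (r *: x) = r *: g x by rewrite linearZ.
rewrite (iter_comp_comm (fun x => esym (gC x))) gy0.
by rewrite (iter_raddf0 (GRing.scale r)).
Qed.

(** On the kernel of a power of e the pencil is 1 - (1 - c) e; on the kernel
    of a power of 1 - e it is c times 1 - (1 - c^-1) (1 - e). *)
Lemma pencil_surj (c d : R) k :
    c * d = 1 -> (forall x, iter k e (iter k f x) = 0) ->
  forall y, exists x, x - e x + c *: e x = y.
Proof.
move=> cd1 ef0 y; have [a [b ->]] := bezout e k k y.
have /(sub_scale_nilpotent_surj (1 - c))[x1 x1E] : iter k e (iter k f b) = 0.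
  exact: ef0.
have /(sub_scale_nilpotent_surj (1 - d))[x2 x2E] :
    iter k f (d *: iter k e a) = 0.
  by rewrite linearZ /= -(iter_comm (compl_comm e)) ef0 scaler0.
exists (x2 + x1).
rewrite [e _]raddfD opprD (addrACA x2) scalerDr (addrACA (x2 - e x2)).
congr (_ + _).
  rewrite -[RHS]scale1r -cd1 -scalerA -x2E scalerBl scale1r opprB addrCA.
  by rewrite /= subKr scalerDr scalerA cd1 scale1r.
by rewrite -x1E scalerBl scale1r opprB addrA addrAC.
Qed.

End Pencil.

(** * Coefficients of Laurent polynomials *)

Section LaurentCoef.
Variable A : pzRingType.
Implicit Types (s : laurent A) (a : A) (i : int).

Lemma laurent_monomE a b i j :
  laurent_monom a i * laurent_monom b j = laurent_monom (a * b) (i + j).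
Proof. exact: laurent_monomM. Qed.

Lemma laurent_monom_coef a i j : (laurent_monom a i)@_j = a *+ (i == j).
Proof. exact: mcoeffU. Qed.

Lemma laurent_coefD s s' i : (s + s')@_i = s@_i + s'@_i.
Proof. exact: mcoeffD. Qed.

Lemma laurent_coef0 i : (0 : laurent A)@_i = 0.
Proof. exact: mcoeff0. Qed.

Lemma laurent_ind (Q : laurent A -> Prop) :
    Q 0 -> (forall s s', Q s -> Q s' -> Q (s + s')) ->
    (forall a i, Q (laurent_monom a i)) -> forall s, Q s.
Proof. by move=> Q0 QD QM; apply: malg_ind => // i a; apply: QM. Qed.

Lemma laurent_coefMC s a i : (s * laurentC a)@_i = s@_i * a.
Proof.
elim/laurent_ind: s => [|s s' IH IH'|b j].
- by rewrite mul0r !laurent_coef0 mul0r.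
- by rewrite mulrDl !laurent_coefD mulrDl IH IH'.
- by rewrite laurent_monomE !laurent_monom_coef addr0 mulrnAl.
Qed.

Lemma laurent_coefXM s i : (laurentX A * s)@_i = s@_(i - 1).
Proof.
elim/laurent_ind: s => [|s s' IH IH'|b j].
- by rewrite mulr0 !laurent_coef0.
- by rewrite mulrDr !laurent_coefD IH IH'.
- rewrite laurent_monomE !laurent_monom_coef mul1r addrC.
  by rewrite [in RHS]eq_sym subr_eq eq_sym.
Qed.

Lemma laurent_bounded s :
  exists n : nat, forall i, (n <= `|i|)%N -> s@_i = 0.
Proof.
elim/laurent_ind: s => [|s s' [n sn] [n' sn']|b j].
- by exists 0%N => i _; rewrite laurent_coef0.
- exists (maxn n n') => i; rewrite geq_max => /andP[ni n'i].
  by rewrite laurent_coefD sn // sn' // addr0.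
- exists `|j|.+1 => i ji; rewrite laurent_monom_coef.
  by case: eqP ji => // ->; rewrite ltnn.
Qed.

Lemma laurentXV : laurentX A * laurent_monom 1 (-1) = 1.
Proof. by rewrite laurent_monomE mul1r subrr. Qed.

End LaurentCoef.

(** * Coefficients in an induced module P[z, z^-1] *)

Section TensorCoef.
Variables (A : pzRingType) (P : lmodType A).

Local Notation PX := (tensor (@laurentC A) P).

(** The coefficient of z^i in an element of P[z, z^-1]. *)
Definition tensor_coef (i : int) : PX -> P :=
  tensor_lift (fun (s : laurent A) (x : P) => s@_i *: x).

Fact tensor_coef_balanced i :
  balanced (@laurentC A) (fun (s : laurent A) (x : P) => s@_i *: x).
Proof.
split=> *; rewrite ?laurent_coefD ?scalerDl ?scalerDr //.
by rewrite laurent_coefMC scalerA.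
Qed.

HB.instance Definition _ i := GRing.isZmodMorphism.Build PX P (tensor_coef i)
  (tensor_lift_is_zmod_morphism (tensor_coef_balanced i)).

Lemma tensor_coefE i s x : tensor_coef i (tens _ s x) = s@_i *: x.
Proof. exact: (tensor_liftE (tensor_coef_balanced i)). Qed.

Lemma tens0r s : tens (@laurentC A) s (0 : P) = 0.
Proof. by apply: (addrI (tens _ s 0)); rewrite -tensDr !addr0. Qed.

Lemma tensBr s (x y : P) :
  tens (@laurentC A) s (x - y) = tens _ s x - tens _ s y.
Proof. by apply/eqP; rewrite eq_sym subr_eq -tensDr subrK. Qed.

Lemma tensor_coefX i (t : PX) :
  tensor_coef i (laurentX A *: t) = tensor_coef (i - 1) t.
Proof.
elim/tensor_ind: t => [|t t' IH IH'|s x].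
- by rewrite scaler0 !raddf0.
- by rewrite scalerDr !raddfD /= IH IH'.
- by rewrite tensZ !tensor_coefE laurent_coefXM.
Qed.

Lemma tensor_coef_map i (e : {linear P -> P}) (t : PX) :
  tensor_coef i (tensor_map e t) = e (tensor_coef i t).
Proof.
elim/tensor_ind: t => [|t t' IH IH'|s x].
- by rewrite !raddf0.
- by rewrite !raddfD /= IH IH'.
- (* Both sides are instances of [tensor_coefE]; each is rewritten on its own,
     as unifying one with the other would unfold the tensor product. *)
  rewrite tensor_mapE; apply: (etrans (tensor_coefE i s (e x))).
  by rewrite tensor_coefE linearZ.
Qed.

Lemma tensor_bounded (t : PX) :
  exists n : nat, forall i, (n <= `|i|)%N -> tensor_coef i t = 0.
Proof.
elim/tensor_ind: t => [|t t' [n tn] [n' tn']|s x].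
- by exists 0%N => i _; rewrite raddf0.
- exists (maxn n n') => i; rewrite geq_max => /andP[ni n'i].
  by rewrite raddfD /= tn // tn' // addr0.
- have [n sn] := laurent_bounded s.
  by exists n => i ni; rewrite tensor_coefE sn // scale0r.
Qed.

End TensorCoef.

(** A family x of bounded support, standing for the coefficients of a
    preimage of 1 (x) y under 1 - e + z e. *)
Section Recurrence.
Variables (V : zmodType) (e : {additive V -> V}) (x : int -> V) (n : nat).
Variable y : V.

Local Notation f := (idfun \- e).

Hypothesis x_bounded : forall i : int, (n <= `|i|)%N -> x i = 0.
Hypothesis x_rec : forall i : int, i != 0 -> f (x i) + e (x (i - 1)) = 0.
Hypothesis x_rec0 : f (x 0) + e (x (-1)) = y.

(** As x n = 0 and e (x (i - 1)) = - f (x i) for i <> 0, each step down from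
    degree n costs one application of e. *)
Lemma recurrence_right j : (j <= n)%N -> iter j e (x (n - j)%N) = 0.
Proof.
elim: j => [_|j IH jn]; first by rewrite subn0 x_bounded.
rewrite iterSr.
have /x_rec : (n - j)%N%:Z != 0 by lia.
have -> : (n - j)%N%:Z - 1 = (n - j.+1)%N by lia.
rewrite addrC => /eqP; rewrite addr_eq0 => /eqP ->.
rewrite -raddfN (iter_comm1 (g := f)) => [|z]; last by rewrite compl_comm.
have -> : iter j e (- x (n - j)%N) = - iter j e (x (n - j)%N).
  by apply/eqP; rewrite -addr_eq0 -iter_raddfD addNr iter_raddf0.
by rewrite IH ?oppr0 ?raddf0 // ltnW.
Qed.

(** Symmetrically, f (x i) = - e (x (i - 1)) for i <> 0, and each step up from
    degree -n costs one application of f. It stops at -1, since the relation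
    at 0 involves y. *)
Lemma recurrence_left j : (j < n)%N -> iter j f (x (- (n - j)%N%:Z)) = 0.
Proof.
elim: j => [_|j IH jn]; first by rewrite subn0 x_bounded // abszN.
rewrite iterSr.
have /x_rec : - (n - j.+1)%N%:Z != 0 by lia.
have -> : - (n - j.+1)%N%:Z - 1 = - (n - j)%N%:Z by lia.
move=> /eqP; rewrite addr_eq0 => /eqP ->.
rewrite -raddfN (iter_comm1 (g := e)) => [|z]; last by rewrite compl_comm.
have -> : iter j f (- x (- (n - j)%N%:Z)) = - iter j f (x (- (n - j)%N%:Z)).
  by apply/eqP; rewrite -addr_eq0 -iter_raddfD addNr iter_raddf0.
by rewrite IH ?oppr0 ?raddf0 // ltnW.
Qed.

Lemma recurrence_near_proj : iter n e (iter n f y) = 0.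
Proof.
have ex0 : iter n e (x 0) = 0 by rewrite -(recurrence_right (leqnn n)) subnn.
have fx1 : iter n f (x (-1)) = 0.
  (* For n = 0 the whole family vanishes. *)
  case: (posnP n) => [n0|n_gt0]; first by rewrite x_bounded ?n0.
  (* Degree -1 is reached after n - 1 steps. *)
  have /recurrence_left : (n.-1 < n)%N by rewrite prednK.
  rewrite (_ : (n - n.-1)%N%:Z = 1); last by lia.
  by rewrite -[in X in _ -> X](prednK n_gt0) /= => ->; rewrite raddf0 subr0.
have e_part : iter n e (iter n f (e (x (-1)))) = 0.
  rewrite (iter_comm1 (f := f) (g := e)) => [|z]; last by rewrite compl_comm.
  by rewrite fx1 raddf0 iter_raddf0.
have f_part : iter n e (iter n f (f (x 0))) = 0.
  rewrite (iter_comm (compl_comm e)) (iter_comm1 (compl_comm e)) ex0.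
  by rewrite raddf0 iter_raddf0.
have efD a b : iter n e (iter n f (a + b))
    = iter n e (iter n f a) + iter n e (iter n f b).
  by rewrite !iter_raddfD.
by rewrite -x_rec0 efD f_part e_part addr0.
Qed.

End Recurrence.

(** * Vanishing of the covering *)

Lemma iter_vanish_le (V : zmodType) (g : {additive V -> V}) m n x :
  (m <= n)%N -> iter m g x = 0 -> iter n g x = 0.
Proof. by move=> /subnK <- gx0; rewrite iterD gx0 iter_raddf0. Qed.

(** On a finitely generated module, a locally nilpotent map is nilpotent. *)
Lemma fg_nilpotent (R : pzRingType) (V : lmodType R) (g : {linear V -> V}) :
    finitely_generated V -> (forall x, exists n, iter n g x = 0) ->
  exists n, forall x, iter n g x = 0.
Proof.
move=> [m [b bP]] g_nil; have [n nP] := fin_all_exists (fun i => g_nil (b i)).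
exists (\max_i n i) => x; have [c ->] := bP x.
rewrite linear_sum big1 // => i _.
by rewrite linearZ /= (iter_vanish_le _ (nP i)) ?scaler0 // leq_bigmax.
Qed.

Lemma coker_eq0 (R : pzRingType) (V W : lmodType R) (g : {linear V -> W}) :
  zero_module (coker g) <-> forall y, exists x, g x = y.
Proof.
split=> [coker0 y|g_surj c].
  have /coker_piP[x gx] : coker_pi g y = coker_pi g 0.
    by rewrite raddf0; apply: coker0.
  by exists x; rewrite gx subr0.
have [y <-] := coker_pi_surj c; have [x gx] := g_surj y.
by rewrite -(raddf0 (coker_pi g)); apply/coker_piP; exists x; rewrite subr0.
Qed.

Section Covering.
Variables (A : pzRingType) (M : seifert A).

Local Notation e := (seifert_end M).
Local Notation E := (tensor_map (phi := @laurentC A) e).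

Lemma tensor_coef_covering i (t : laurent_mod M) :
  tensor_coef i (covering_map t)
    = (idfun \- e) (tensor_coef i t) + e (tensor_coef (i - 1) t).
Proof.
rewrite /covering_map raddfD raddfB; congr (_ - _ + _).
  exact: tensor_coef_map.
by rewrite [LHS]tensor_coefX tensor_coef_map.
Qed.

Lemma near_projection_of_covering0 :
  zero_module (covering M) -> is_near_projection M.
Proof.
move=> /coker_eq0 cov_surj.
pose ef : {linear M -> M} := e \o (idfun \- e).
apply: (fg_nilpotent (g := ef) (@seifert_fg _ M)) => y.
(* t is a preimage of 1 (x) y. *)
have [t tE] := cov_surj (tens _ 1 y); have [n tn] := tensor_bounded t.
exists n; rewrite (iter_comp_comm (compl_comm e)).
apply: (recurrence_near_proj (x := fun i => tensor_coef i t)) => [//|i i0|].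
  rewrite -tensor_coef_covering tE tensor_coefE.
  by rewrite laurent_monom_coef eq_sym (negPf i0) scale0r.
rewrite -[-1]sub0r -tensor_coef_covering tE tensor_coefE.
by rewrite laurent_monom_coef scale1r.
Qed.

(** Near-projections are preserved by extension of scalars to A[z, z^-1]. *)
Lemma tensor_map_near_proj k :
    (forall x : M, iter k (e \o (idfun \- e)) x = 0) ->
  forall t, iter k (E \o (idfun \- E)) t = 0.
Proof.
move=> ef0 t.
pose EF : {linear laurent_mod M -> laurent_mod M} := E \o (idfun \- E).
rewrite -[iter k _]/(iter k EF).
elim/tensor_ind: t => [|t t' IH IH'|s x].
- exact: iter_raddf0.
- by rewrite iter_raddfD IH IH' addr0.
have -> : iter k EF (tens _ s x) = tens _ s (iter k (e \o (idfun \- e)) x).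
  elim: k {ef0} => [//|j IH]; rewrite !iterS IH.
  set y := iter j _ x; transitivity (E (tens _ s y - tens _ s (e y))).
    by congr (E (_ - _)); exact: tensor_mapE.
  by rewrite -tensBr; exact: tensor_mapE.
by rewrite ef0 tens0r.
Qed.

Lemma covering0_of_near_projection :
  is_near_projection M -> zero_module (covering M).
Proof.
move=> [k /tensor_map_near_proj EF0]; apply/coker_eq0.
apply: (pencil_surj (e := E) (laurentXV A) (k := k)) => t.
exact: etrans (esym (iter_comp_comm (compl_comm E) k t)) (EF0 t).
Qed.

End Covering.

(** * Kernels as modules, and direct summands *)

Section Kernel.
Variables (R : pzRingType) (V W : lmodType R) (h : {linear V -> W}).

Definition kernel_pred : {pred V} := fun x => h x == 0.

Fact kernel_submod_closed : submod_closed kernel_pred.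
Proof.
split=> [|a x y]; rewrite !unfold_in /kernel_pred ?raddf0 // linearP.
by move=> /eqP-> /eqP->; rewrite scaler0 addr0.
Qed.
HB.instance Definition _ :=
  GRing.isSubmodClosed.Build R V kernel_pred kernel_submod_closed.

(** The kernel of h, as a submodule of V. *)
Record kernel :=
  Kernel { kernel_val : V; kernel_valP : kernel_val \in kernel_pred }.
HB.instance Definition _ := [isSub for kernel_val].
HB.instance Definition _ := [Choice of kernel by <:].
HB.instance Definition _ := [SubChoice_isSubLmodule of kernel by <:].

Lemma kernel_valE (x : kernel) : h (val x) = 0.
Proof. by apply/eqP; exact: (valP x). Qed.

Lemma kernel_exists y : h y = 0 -> exists x : kernel, val x = y.
Proof. by move=> /eqP hy; exists (Kernel hy). Qed.

End Kernel.

Section KernelEnd.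
Variables (R : pzRingType) (V : lmodType R) (h g : {linear V -> V}).
Hypothesis hgC : forall x, h (g x) = g (h x).

Fact kernel_end_subproof (x : kernel h) : g (val x) \in kernel_pred h.
Proof. by rewrite unfold_in /kernel_pred hgC kernel_valE raddf0. Qed.

(** The restriction to the kernel of h of an endomorphism commuting with h. *)
Definition kernel_end (x : kernel h) : kernel h :=
  Kernel (kernel_end_subproof x).

Fact kernel_end_is_linear : linear kernel_end.
Proof. by move=> a x y; apply: val_inj; rewrite /= !linearP. Qed.

Lemma val_iter_kernel_end n x : val (iter n kernel_end x) = iter n g (val x).
Proof. by elim: n => //= n ->. Qed.

Lemma val_iter_kernel_compl n x :
  val (iter n (fun y => y - kernel_end y) x) = iter n (idfun \- g) (val x).
Proof. by elim: n => // n IH; rewrite !iterS -IH; exact: raddfB. Qed.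

End KernelEnd.

Lemma fg_surj (R : pzRingType) (V W : lmodType R) (p : {linear V -> W}) :
  (forall y, exists x, p x = y) -> finitely_generated V -> finitely_generated W.
Proof.
move=> p_surj [n [g gP]]; exists n, (p \o g) => y.
have [x <-] := p_surj y; have [c ->] := gP x; exists c.
by rewrite linear_sum; apply: eq_bigr => i _; rewrite linearZ.
Qed.

Lemma projective_retract (R : pzRingType) (V W : lmodType R)
    (p : {linear V -> W}) (i : {linear W -> V}) :
  cancel i p -> projective V -> projective W.
Proof.
move=> iK projV X Y q g q_surj.
have [k kP] := projV X Y q (g \o p) q_surj.
by exists (k \o i) => x; rewrite /= kP /= iK.
Qed.

Section Summand.
Variables (A : pzRingType) (M : seifert A).
Local Notation e := (seifert_end M).
Variables h : {linear M -> M}.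
Hypothesis heC : forall x, h (e x) = e (h x).

HB.instance Definition _ := GRing.isLinear.Build A (kernel h) (kernel h) *:%R
  (kernel_end heC) (kernel_end_is_linear heC).

Variable p : {linear M -> kernel h}.
Hypothesis pK : forall x, p (val x) = x.

(** The kernel of h with the restriction of e, as a Seifert module. The
    retraction p is what makes it finitely generated and projective. *)
Definition kernel_seifert : seifert A :=
  @Seifert A (kernel h) (kernel_end heC)
    (fg_surj (fun y => ex_intro _ (val y) (pK y)) (@seifert_fg _ M))
    (projective_retract (i := val) pK (@seifert_proj _ M)).

End Summand.

(** * Splitting a near-projection *)

Section Splitting.
Variables (R : pzRingType) (V : lmodType R) (e : {linear V -> V}) (k : nat).

Local Notation f := (idfun \- e).

(** The linear map r sends x to its two components in ker (1 - e)^k and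
    ker e^k; the two conditions say that it is inverse to the sum map. *)
Lemma near_projection_split :
    (forall x, iter k e (iter k f x) = 0) ->
  exists r : {linear V -> (kernel (iter k f) * kernel (iter k e))%type},
    (forall x, val (r x).1 + val (r x).2 = x) /\
    (forall u v, r (val u + val v) = (u, v)).
Proof.
move=> ef0; pose K := (kernel (iter k f) * kernel (iter k e))%type.
have split_ex x : exists w : K, val w.1 + val w.2 = x.
  have [a [b ->]] := bezout e k k x.
  have [u uE] : exists u : kernel (iter k f), val u = iter k e a.
    apply: kernel_exists.
    exact: etrans (esym (iter_comm (compl_comm e) k k a)) (ef0 a).
  have [v vE] : exists v : kernel (iter k e), val v = iter k f b.
    by apply: kernel_exists; exact: ef0.
  by exists (u, v); rewrite /= uE vE.
have split_inj (w w' : K) :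
    val w.1 + val w.2 = val w'.1 + val w'.2 -> w = w'.
  case: w w' => [u v] [u' v'] /= eq_sum.
  have eq_sub : val (u - u') = val (v' - v).
    rewrite !raddfB /=; apply/eqP; rewrite subr_eq addrAC.
    by rewrite (addrC (kernel_val v')) -eq_sum addrK.
  have u0 : val (u - u') = 0.
    apply: (@ker_iter_disjoint _ e k k); last exact: kernel_valE.
    by rewrite eq_sub; exact: kernel_valE.
  have v0 : val (v' - v) = 0 by rewrite -eq_sub.
  have -> : u = u' by apply/eqP; rewrite -subr_eq0; apply/eqP/val_inj.
  by have -> : v' = v by apply/eqP; rewrite -subr_eq0; apply/eqP/val_inj.
have [r rP] := choice split_ex.
have r_lin : linear r.
  move=> a x y; apply: split_inj; rewrite rP -{1}(rP x) -{1}(rP y).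
  by rewrite scalerDr addrACA; congr (_ + _); rewrite -linearP.
pose rl : {linear V -> K} :=
  HB.pack r (GRing.isLinear.Build R V K *:%R r r_lin).
by exists rl; split=> [//|u v]; apply: split_inj; rewrite rP.
Qed.

End Splitting.

Lemma decomposition_of_near_projection (A : pzRingType) (M : seifert A) :
  is_near_projection M ->
  exists Mplus Mminus : seifert A,
    [/\ seifert_iso M (seifert_sum Mplus Mminus),
        is_unipotent Mplus & is_nilpotent Mminus].
Proof.
move=> [k nearM]; pose e := seifert_end M.
pose f : {linear M -> M} := idfun \- e.
have ef0 x : iter k e (iter k f x) = 0 by rewrite -near_projE nearM.
have [r [sumr rK]] := near_projection_split ef0.
have FC x : iter k f (e x) = e (iter k f x).
  by apply: iter_comm1 => y; rewrite [RHS](compl_comm e).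
have EC x : iter k e (e x) = e (iter k e x) by rewrite iter_comm1.
have pK u : (fst \o r) (val u) = u.
  by have := rK u 0; rewrite raddf0 addr0 /= => ->.
have qK u : (snd \o r) (val u) = u.
  by have := rK 0 u; rewrite raddf0 add0r /= => ->.
exists (kernel_seifert FC pK), (kernel_seifert EC qK); split.
- exists r; split.
    exists (fun w => val w.1 + val w.2) => [//|[u v]]; exact: rK.
  (* e x is the sum of the images under e of the components of x. *)
  move=> x; rewrite -{1}(sumr x) raddfD.
  exact: (rK (kernel_end FC (r x).1) (kernel_end EC (r x).2)).
- exists k => x; apply: val_inj; rewrite raddf0.
  exact: etrans (val_iter_kernel_compl FC k x) (kernel_valE x).
- exists k => x; apply: val_inj; rewrite raddf0.
  exact: etrans (val_iter_kernel_end EC k x) (kernel_valE x).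
Qed.

(** * Unipotent, nilpotent and direct sums *)

Lemma unipotent_near_projection (A : pzRingType) (M : seifert A) :
  is_unipotent M -> is_near_projection M.
Proof.
move=> [k uniM]; exists k => x; rewrite near_projE.
by rewrite [X in iter k _ X]uniM iter_raddf0.
Qed.

Lemma nilpotent_near_projection (A : pzRingType) (M : seifert A) :
  is_nilpotent M -> is_near_projection M.
Proof.
move=> [k nilM]; exists k => x; rewrite near_projE.
by rewrite (iter_comm (compl_comm _)) nilM iter_raddf0.
Qed.

Lemma near_projection_sum (A : pzRingType) (M N : seifert A) :
  is_near_projection M -> is_near_projection N ->
  is_near_projection (seifert_sum M N).
Proof.
move=> [m nearM] [n nearN]; exists (maxn m n) => -[x y].
pose gM : {linear M -> M} := seifert_end M \o (idfun \- seifert_end M).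
pose gN : {linear N -> N} := seifert_end N \o (idfun \- seifert_end N).
have -> : (0 : seifert_sum M N) = (iter (maxn m n) gM x, iter (maxn m n) gN y).
  by rewrite (iter_vanish_le (g := gM) (leq_maxl m n) (nearM x))
             (iter_vanish_le (g := gN) (leq_maxr m n) (nearN y)).
by elim: (maxn m n) => //= j ->.
Qed.

Lemma near_projection_iso (A : pzRingType) (M N : seifert A) :
  seifert_iso M N -> is_near_projection N -> is_near_projection M.
Proof.
move=> [g [/bij_inj g_inj gE]] [k nearN]; exists k => x; apply: g_inj.
rewrite raddf0 -[RHS](nearN (g x)).
by elim: {+}k => //= j <-; rewrite gE raddfB /= gE.
Qed.

Theorem proposition2p3 (A : pzRingType) (M : seifert A) :
  (zero_module (covering M) <-> is_near_projection M) /\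
  (is_near_projection M <->
     exists Mplus Mminus : seifert A,
       [/\ seifert_iso M (seifert_sum Mplus Mminus),
           is_unipotent Mplus & is_nilpotent Mminus]).
Proof.
split; split.
- exact: near_projection_of_covering0.
- exact: covering0_of_near_projection.
- exact: decomposition_of_near_projection.
move=> [Mplus [Mminus [isoM uniM nilM]]]; apply: (near_projection_iso isoM).
apply: near_projection_sum.
  exact: unipotent_near_projection.
exact: nilpotent_near_projection.
Qed.
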